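(* Let $q=p^{\alpha}$, where $p$ is a prime and $\alpha$ is a positive integer, and list the elements of $GF(q)$ as $a_0=0,a_1,\dots,a_{q-1}$. Let $t$ be an integer with $1\leq t<\frac{q-1}{2}$, and let $A=[a_{ij}]_{0\le i,j\le q-1}$ be the $q\times q$ matrix over $GF(q)$ with entries $a_{ij}=a_j^{t}-a_i^{t}$ (computed in $GF(q)$). Then $A$ is skew symmetric ($A^T=-A$) and self orthogonal, i.e. $AA^T=\mathbf{0}$ over $GF(q)$.
   Context: A square matrix $C$ over $GF(q)$ is called self orthogonal if $CC^T=\mathbf{0}$ (the zero matrix) over $GF(q)$. *)

(* Defs.v *)
From mathcomp Require Import all_boot all_order all_algebra.
Set Implicit Arguments.
Unset Strict Implicit.
Unset Printing Implicit Defensive.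
Import GRing.Theory.
Local Open Scope ring_scope.

Definition skew_symmetric (F : fieldType) (n : nat) (C : 'M[F]_n) : Prop :=
  C^T = - C.

Definition self_orthogonal (F : fieldType) (n : nat) (C : 'M[F]_n) : Prop :=
  C *m C^T = 0.

Definition power_diff_mx (F : fieldType) (n : nat) (a : 'I_n -> F) (t : nat) :
    'M[F]_n :=
  \matrix_(i < n, j < n) (a j ^+ t - a i ^+ t).

(* Main.v *)
(* Every entry of A A^T is a combination of the power sums of exponents 0, t
   and 2t over the field, and the power sum of exponent k < q - 1 vanishes: it
   is q = 0 for k = 0, and for k > 0 the at most k roots of X^k - 1 leave a
   nonzero c with c^k <> 1, while the permutation x |-> c x shows that the sum
   is fixed by multiplication by c^k. *)

Require Import Defs.
From mathcomp Require Import all_boot all_order all_algebra.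
From mathcomp Require Import ring.
Set Implicit Arguments.
Unset Strict Implicit.
Unset Printing Implicit Defensive.
Import GRing.Theory.
Local Open Scope ring_scope.

(** Translation by 1 permutes [F], so the sum of all elements does not change when 1 is added to
    each of them. *)
Lemma card_finField_natr0 (F : finFieldType) : #|F|%:R = 0 :> F.
Proof.
have shift : \sum_(x : F) x = \sum_(x : F) x + #|F|%:R.
  by rewrite [LHS](reindex_inj (addIr 1)) /= big_split /= sumr_const.
by apply: (addrI (\sum_(x : F) x)); rewrite addr0 -shift.
Qed.

Lemma expf_neq1_exists (F : finFieldType) (k : nat) :
  (0 < k)%N -> (k < #|F|.-1)%N -> exists2 c : F, c != 0 & c ^+ k != 1.
Proof.
move=> k_gt0 lt_kq.
case: (pickP (fun c : F => (c != 0) && (c ^+ k != 1))) => [c /andP[]|all1].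
  by exists c.
have roots1 : all k.-unity_root (enum (predC1 (0 : F))).
  apply/allP=> x; rewrite mem_enum inE => x_neq0.
  by have := all1 x; rewrite x_neq0 unity_rootE => /negbFE.
have := max_unity_roots k_gt0 roots1 (enum_uniq _).
by rewrite -cardE cardC1 leqNgt lt_kq.
Qed.

Lemma sum_expf_eq0 (F : finFieldType) (k : nat) :
  (k < #|F|.-1)%N -> \sum_(x : F) x ^+ k = 0.
Proof.
case: (posnP k) => [-> _|k_gt0 lt_kq].
  (* Since [0 ^+ 0 = 1], the term at [x = 0] also counts as 1. *)
  under eq_bigr do rewrite expr0.
  by rewrite sumr_const card_finField_natr0.
have [c c_neq0 ck_neq1] := expf_neq1_exists k_gt0 lt_kq.
set S := \sum_x _.
have scaleS : c ^+ k * S = S.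
  rewrite /S mulr_sumr [RHS](reindex_inj (mulfI c_neq0)) /=.
  by apply: eq_bigr => x _; rewrite exprMn.
apply/eqP; move/eqP: scaleS.
by rewrite -subr_eq0 -{2}[S]mul1r -mulrBl mulf_eq0 subr_eq0 (negPf ck_neq1).
Qed.

Theorem theorem1 (p alpha q : nat) (hp : prime p) (halpha : (0 < alpha)%N)
    (hq : q = (p ^ alpha)%N)
    (F : finFieldType) (hF : #|F| = q)
    (a : 'I_q -> F) (ha : bijective a)
    (ha0 : forall i : 'I_q, val i = 0%N -> a i = 0)
    (t : nat) (ht1 : (1 <= t)%N) (ht2 : (2 * t < q - 1)%N) :
  skew_symmetric (power_diff_mx a t) /\ self_orthogonal (power_diff_mx a t).
Proof.
split; first by apply/matrixP=> i j; rewrite !mxE opprB.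
have sum_a k : (k < q - 1)%N -> \sum_j a j ^+ k = 0.
  (* Only the bound is rewritten, as [q] also occurs in the type of [a]. *)
  rewrite subn1 -[X in X.-1]hF => lt_kq; rewrite -[RHS](sum_expf_eq0 lt_kq).
  by rewrite [RHS](reindex a) //; apply: onW_bij.
have lt_tq : (t < q - 1)%N.
  by apply: leq_ltn_trans ht2; rewrite leq_pmull.
apply/matrixP=> i j; rewrite !mxE.
(* Expanded product of the entries [(i, k)] and [(j, k)]; the factor [a k ^+ 0] makes the constant
   term a power sum, so [sum_a] kills all three. *)
transitivity (\sum_k (a k ^+ (2 * t) - (a i ^+ t + a j ^+ t) * a k ^+ t
                       + a i ^+ t * a j ^+ t * a k ^+ 0)).
  apply: eq_bigr => k _; rewrite !mxE mulnC exprM expr0; ring.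
rewrite big_split sumrB /= -!mulr_sumr !sum_a ?mulr0 ?subr0 ?addr0 //.
exact: leq_ltn_trans lt_tq.
Qed.
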